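(* The punctured Nordstrom-Robinson code $\mathcal{PN}$ is $\mathrm{Aut}(\mathcal{PN})$-completely transitive, i.e. each part $\mathcal{PN}_i$ of its distance partition is an orbit of $\mathrm{Aut}(\mathcal{PN})$.
   Context: $\Gamma_{15}$ is the binary Hamming graph on $\mathbb{F}_2^{15}$; $\mathrm{Aut}(\Gamma_{15})=T\rtimes L$, with $T$ the translations of $\mathbb{F}_2^{15}$ and $L\cong S_{15}$ the coordinate permutations. For a code $C\subseteq\mathbb{F}_2^{15}$, $\mathrm{Aut}(C)$ is its setwise stabiliser in $\mathrm{Aut}(\Gamma_{15})$; with $d(\gamma,C)$ the Hamming distance from $\gamma$ to the nearest codeword and $\rho$ the covering radius, $C_i=\{\gamma:d(\gamma,C)=i\}$ for $0\le i\le\rho$ form the distance partition. $C$ is $X$-completely transitive if each $C_i$ is an $X$-orbit. Nordstrom-Robinson code: let $\mathcal{G}$ be the $[24,12,8]$ extended binary Golay code in $\mathbb{F}_2^{24}$ with $(1^8,0^{16})\in\mathcal{G}$; let $J^*=\{1,\dots,8\}$, $J=\{9,\dots,24\}$, $\mathcal{D}^0=\{\alpha\in\mathcal{G}:\mathrm{supp}(\alpha)\cap J^*=\emptyset\}$ and $\mathcal{D}^i=\{\alpha\in\mathcal{G}:\mathrm{supp}(\alpha)\cap J^*=\{i,8\}\}$ for $1\le i\le7$. Then $\mathcal{NR}\subseteq\mathbb{F}_2^{16}$ is the set of restrictions to $J$ of the vectors in $\bigcup_{i=0}^7\mathcal{D}^i$. The punctured Nordstrom-Robinson code $\mathcal{PN}\subseteq\mathbb{F}_2^{15}$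 is obtained by deleting the first coordinate from every codeword of $\mathcal{NR}$. *)

(* Defs.v *)
From mathcomp Require Import all_boot all_order all_fingroup all_algebra.
Set Implicit Arguments. Unset Strict Implicit. Unset Printing Implicit Defensive.
Import GRing.Theory.
Local Open Scope ring_scope.

(* Binary vectors of length n: F_2^n as row vectors over 'F_2.
   Coordinates are 0-based: paper's coordinate k is index k-1 here. *)
Notation vec n := 'rV['F_2]_n.

Definition wt n (x : vec n) : nat := #|[set i : 'I_n | x 0 i != 0]|.
Definition hdist n (x y : vec n) : nat := #|[set i : 'I_n | x 0 i != y 0 i]|.

(* d(x, C): distance to the nearest codeword (C assumed nonempty;
   n is an upper bound of every Hamming distance). *)
Definition dist_code n (C : {set vec n}) (x : vec n) : nat :=
  \big[minn/n]_(c in C) hdist x c.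

Definition cov_radius n (C : {set vec n}) : nat :=
  \max_(x : vec n) dist_code C x.

Definition dpart n (C : {set vec n}) (i : nat) : {set vec n} :=
  [set x | dist_code C x == i].

(* Aut(Gamma_n) = T x| L: an element is a pair (t, s) of a translation
   vector t and a coordinate permutation s, acting by x |-> s(x) + t. *)
Definition hact n (g : vec n * {perm 'I_n}) (x : vec n) : vec n :=
  col_perm g.2 x + g.1.

Definition AutC n (C : {set vec n}) : {set vec n * {perm 'I_n}} :=
  [set g | hact g @: C == C].

Definition orbitX n (X : {set vec n * {perm 'I_n}}) (x : vec n) : {set vec n} :=
  [set hact g x | g in X].

Definition completely_transitive n (X : {set vec n * {perm 'I_n}})
    (C : {set vec n}) : Prop :=
  forall i, (i <= cov_radius C)%N -> exists x, dpart C i = orbitX X x.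

Definition is_ext_golay (G : {set vec 24}) : Prop :=
  [/\ 0 \in G,
      {in G &, forall x y, x + y \in G},
      #|G| = (2 ^ 12)%N,
      {in G, forall x, x != 0 -> (8 <= wt x)%N}
    & exists2 x, x \in G & wt x = 8%N].

Definition one8 : vec 24 := \row_(k < 24) (if (k < 8)%N then 1 else 0).

Definition suppJstar (a : vec 24) : {set 'I_24} :=
  [set k : 'I_24 | (k < 8)%N && (a 0 k != 0)].

(* D^0 union D^1 .. D^7 : supp /\ J* is empty or equals {i, 8} for 1<=i<=7,
   i.e. indices {i', 7} with i' < 7 *)
Definition Dunion (G : {set vec 24}) : {set vec 24} :=
  [set a in G | (suppJstar a == set0)
     || [exists i : 'I_24, (i < 7)%N && (suppJstar a == [set i; inord 7])]].

Definition NR (G : {set vec 24}) : {set vec 16} :=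
  [set \row_(j < 16) a 0 (@rshift 8 16 j) | a : vec 24 in Dunion G].

Definition puncture (C : {set vec 16}) : {set vec 15} :=
  [set \row_(j < 15) c 0 (@rshift 1 15 j) | c : vec 16 in C].

Definition PN (G : {set vec 24}) : {set vec 15} := puncture (NR G).

(* Main.v *)
(** A word is bent when it is at distance at least 6 from every word of the
    Reed-Muller code RM(1,4).  Restricting G to the complement J of the octad J*
    and counting cosets shows that every word of G meets J* evenly.  Hence at
    least 32 words of G vanish on J*; by Plotkin's bound they form a [16,5,8]
    code, which is RM(1,4) for a suitable labelling of J by F_2^4.  The words
    meeting J* in {i, 8} then form cosets of RM(1,4) represented by seven bent
    quadratic forms with bent pairwise sums, that is a Kerdock set.  There are
    eight Kerdock sets, and the linear maps [twist k] permute them transitively,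
    so PN(G) is a coordinate permutation of one fixed code of 256 words.  For that
    code, a group A_7 fixing 0 is transitive on the words of weight i at distance
    i from the code (the 15 points, the 105 pairs and the 35 lines of PG(3,2)),
    Aut is transitive on the codewords, and the covering radius is 3. *)
Require Import Defs.
From mathcomp Require Import all_boot all_order all_fingroup all_algebra.
From mathcomp Require Import zify ring.
Set Implicit Arguments. Unset Strict Implicit. Unset Printing Implicit Defensive.
Import GRing.Theory.
Local Open Scope ring_scope.

(** * Binary vectors *)

Lemma F2P (a : 'F_2) : {a = 0} + {a = 1}.
Proof. by case: a => [[|[|m]] Hm]; [left|right|]; try exact: val_inj. Qed.

Lemma F2_addb (a b : 'F_2) : (a + b != 0) = (a != 0) (+) (b != 0).
Proof. by case: (F2P a) => ->; case: (F2P b) => ->. Qed.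

Lemma F2_eqb (a b : 'F_2) : (a != 0) = (b != 0) -> a = b.
Proof. by case: (F2P a) => ->; case: (F2P b) => ->. Qed.

Lemma F2_neqE (a b : 'F_2) : (a != b) = (a + b != 0).
Proof. by case: (F2P a) => ->; case: (F2P b) => ->. Qed.

Ltac f2_case x := let e := fresh in case: (F2P x) => e; rewrite e; clear e.

Section Vectors.
Variable n : nat.
Implicit Types x y z : vec n.

Lemma addF2v x : x + x = 0.
Proof. by apply/rowP => i; rewrite !mxE; f2_case (x 0 i); apply: val_inj. Qed.

Lemma addF2K x y : x + y + y = x.
Proof. by rewrite -addrA addF2v addr0. Qed.

Lemma addF2Kl x y : x + (x + y) = y.
Proof. by rewrite addrA addF2v add0r. Qed.

Lemma addF2_eq0 x y : x + y = 0 -> x = y.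
Proof. by move=> xy0; rewrite -[LHS](addF2K _ y) xy0 add0r. Qed.

Lemma wtE x : wt x = (\sum_(i < n) (x 0%R i != 0%R))%N.
Proof.
by rewrite /wt -sum1dep_card big_mkcond /=; apply: eq_bigr => i _; case: eqP.
Qed.

Lemma wtD x y :
  (wt (x + y) + (\sum_(i < n) ((x 0%R i != 0%R) && (y 0%R i != 0%R))).*2 =
  wt x + wt y)%N.
Proof.
rewrite !wtE -mul2n big_distrr -!big_split /=; apply: eq_bigr => i _.
by rewrite mxE F2_addb; do 2!case: (_ != 0).
Qed.

Lemma leq_wtD x y : (wt (x + y) <= wt x + wt y)%N.
Proof. by rewrite -wtD leq_addr. Qed.

Lemma odd_wtD x y : odd (wt (x + y)) = odd (wt x) (+) odd (wt y).
Proof. by rewrite -oddD -wtD oddD odd_double addbF. Qed.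

Lemma wt0 : wt (0 : vec n) = 0%N.
Proof. by rewrite wtE big1 // => i _; rewrite mxE. Qed.

Lemma wt_eq0 x : (wt x == 0%N) = (x == 0).
Proof.
apply/idP/eqP => [|->]; last by rewrite wt0.
rewrite /wt cards_eq0 => /eqP x0; apply/rowP => i; rewrite mxE.
by apply/eqP; apply: contraFT (in_set0 i) => xi; rewrite -x0 inE.
Qed.

Lemma wt_delta (i : 'I_n) : wt (delta_mx 0 i : vec n) = 1%N.
Proof.
rewrite /wt (_ : [set _ | _] = [set i]) ?cards1 //.
by apply/setP => j; rewrite !inE mxE eqxx /=; case: (j == i).
Qed.

Lemma wt_const1D x : (wt (const_mx 1%R + x) + wt x)%N = n.
Proof.
rewrite !wtE -big_split /= -[RHS]card_ord -sum1_card; apply: eq_bigr => i _.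
by rewrite !mxE; f2_case (x 0%R i).
Qed.

Lemma hdistE x y : hdist x y = wt (x + y).
Proof. by apply: eq_card => i; rewrite !inE mxE F2_neqE. Qed.

Lemma sum_delta x : x = \sum_(i <- enum [set i | x 0 i != 0]) delta_mx 0 i.
Proof.
rewrite big_enum /= [LHS]row_sum_delta (bigID (fun i => x 0 i != 0)) /=.
rewrite [X in _ + X]big1 ?addr0 => [|i /negPn/eqP->]; last by rewrite scale0r.
apply: eq_big => [i|i]; rewrite ?inE //; f2_case (x 0 i) => //.
by rewrite scale1r.
Qed.

End Vectors.

Lemma wt_row_mx m n (x : vec m) (y : vec n) :
  wt (row_mx x y) = (wt x + wt y)%N.
Proof.
rewrite !wtE big_split_ord /=; congr addn; apply: eq_bigr => i _.
  by rewrite row_mxEl.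
by rewrite row_mxEr.
Qed.

(** * Vectors as lists of bits *)

Definition bits n (x : vec n) : seq bool := [seq x 0 i != 0 | i <- enum 'I_n].

Definition xorv (v w : seq bool) : seq bool := [seq p.1 (+) p.2 | p <- zip v w].

Definition permv (s : seq nat) (v : seq bool) : seq bool :=
  [seq nth false v i | i <- s].

Definition wtv (v : seq bool) : nat := count id v.

Section Bits.
Variable n : nat.
Implicit Types x y : vec n.

Lemma size_bits x : size (bits x) = n.
Proof. by rewrite size_map size_enum_ord. Qed.

Lemma nth_bits x (i : 'I_n) : nth false (bits x) i = (x 0 i != 0).
Proof. by rewrite (nth_map i) ?size_enum_ord // nth_ord_enum. Qed.

Lemma bits_inj : injective (@bits n).
Proof.
move=> x y E; apply/rowP => i; apply: F2_eqb.
by rewrite -!nth_bits E.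
Qed.

Lemma bitsP x v : size v = n ->
  (forall i : 'I_n, nth false v i = (x 0 i != 0)) -> bits x = v.
Proof.
move=> sv vx; apply: (@eq_from_nth _ false); rewrite size_bits ?sv // => i lti.
by rewrite (nth_bits x (Ordinal lti)) -vx.
Qed.

Lemma bits_onto v : size v = n -> exists x, bits x = v.
Proof.
move=> sv; exists (\row_i (nth false v i)%:R); apply: bitsP => // i.
by rewrite mxE; case: nth.
Qed.

Lemma bits0 : bits (0 : vec n) = nseq n false.
Proof. by apply: bitsP; rewrite ?size_nseq // => i; rewrite nth_nseq mxE if_same. Qed.

Lemma size_xorv v w : size v = n -> size w = n -> size (xorv v w) = n.
Proof. by move=> sv sw; rewrite size_map size_zip sv sw minnn. Qed.

Lemma nth_xorv v w i : size v = size w ->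
  nth false (xorv v w) i = nth false v i (+) nth false w i.
Proof.
move=> sE; have [lti|gei] := ltnP i (size v).
  by rewrite (nth_map (false, false)) ?size_zip -?sE ?minnn // nth_zip.
by rewrite !nth_default // -?sE // size_map size_zip -sE minnn.
Qed.

Lemma bitsD x y : bits (x + y) = xorv (bits x) (bits y).
Proof.
apply: bitsP => [|i]; first by rewrite size_xorv ?size_bits.
by rewrite nth_xorv ?size_bits // !nth_bits mxE F2_addb.
Qed.

Lemma wt_bits x : wtv (bits x) = wt x.
Proof. by rewrite /wtv -sum1_count big_map big_enum_cond /= sum1dep_card. Qed.

Lemma bits_col_perm (s : {perm 'I_n}) x :
  bits (col_perm s x) = permv [seq val (s i) | i <- enum 'I_n] (bits x).
Proof. by rewrite /permv -map_comp; apply: eq_map => i /=; rewrite nth_bits mxE. Qed.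

Lemma perm_of_seq (s : seq nat) : perm_eq s (iota 0 n) ->
  exists p : {perm 'I_n}, [seq val (p i) | i <- enum 'I_n] = s.
Proof.
move=> sP; have sz : size s = n by rewrite (perm_size sP) size_iota.
have lt_s (i : 'I_n) : (nth 0%N s i < n)%N.
  have : nth 0%N s i \in s by rewrite mem_nth ?sz.
  by rewrite (perm_mem sP) mem_iota.
have inj : injective (fun i => Ordinal (lt_s i)).
  move=> i j [/eqP]; rewrite nth_uniq ?sz ?(perm_uniq sP) ?iota_uniq //.
  by move/eqP/val_inj.
exists (perm inj); apply: (@eq_from_nth _ 0%N); rewrite size_map size_enum_ord ?sz //.
move=> i lti; rewrite (nth_map (Ordinal lti)) ?size_enum_ord // permE /=.
by rewrite nth_enum_ord.
Qed.

End Bits.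

(** * Enumeration of words and the Reed-Muller code RM(1,4) *)

Fixpoint words n : seq (seq bool) :=
  if n is m.+1 then [seq b :: w | b <- [:: false; true], w <- words m]
  else [:: [::]].

Lemma mem_words n v : size v = n -> v \in words n.
Proof.
elim: n v => [|n IHn] [|b v] // [/IHn vn].
by apply: (allpairs_f cons _ vn); case: b.
Qed.

Lemma size_words n v : v \in words n -> size v = n.
Proof.
elim: n v => [|n IHn] v; first by rewrite inE => /eqP->.
by case/allpairsP => [[b w]] [_ /IHn wn ->]; rewrite /= wn.
Qed.

(* For a = [:: c; a0; a1; ...], the values of c + a0 p_0 + a1 p_1 + ... at the
   points p = 0, 1, 2, ... with binary digits p_k. *)
Definition affine (a : seq bool) : seq bool :=
  foldl (fun v b => v ++ [seq b (+) c | c <- v]) [:: head false a] (behead a).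

Definition rm14 : seq (seq bool) := [seq affine a | a <- words 5].

Lemma affineP (c a0 a1 a2 a3 t0 t1 t2 t3 : bool) :
  nth false (affine [:: c; a0; a1; a2; a3]) (t0 + t1.*2 + t2 * 4 + t3 * 8) =
  c (+) (a0 && t0) (+) (a1 && t1) (+) (a2 && t2) (+) (a3 && t3) :> bool.
Proof.
case: t0; case: t1; case: t2; case: t3;
  by case: c; case: a0; case: a1; case: a2; case: a3.
Qed.

(** * The [16,5,8] code *)

Section LinearCode.
Variables (n : nat) (E : {set vec n}).
Hypothesis E0 : 0 \in E.
Hypothesis ED : {in E &, forall x y, x + y \in E}.

(** Over F_2, a set containing 0 and closed under addition is a subspace. The rows of [M] list all
    its words, so a row base of [M] parametrises it injectively by F_2^r. *)
Lemma linear_basis : exists r (A : 'M['F_2]_(r, n)),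
  #|E| = (2 ^ r)%N /\ (forall v, v \in E <-> exists w, v = w *m A).
Proof.
pose M := \matrix_(i < #|E|) enum_val i.
pose B := row_base M.
have BP v : v \in E <-> exists w, v = w *m B.
  split=> [Ev|[w ->]].
    have : (v <= B)%MS.
      rewrite eq_row_base -(enum_rankK_in Ev Ev).
      by rewrite -(rowK (fun i => enum_val i)) row_sub.
    by case/submxP => w ->; exists w.
  have : (w *m B <= M)%MS by rewrite -(eq_row_base M) submxMl.
  case/submxP => z ->; rewrite mulmx_sum_row; elim/big_ind: _ => // i _.
  rewrite rowK; f2_case (z 0 i); rewrite ?scale0r ?scale1r //.
  exact: enum_valP.
exists (\rank M), B; split=> //.
have inj : injective (fun w : 'rV_(\rank M) => w *m B).
  exact/row_free_inj/row_base_free.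
rewrite -[RHS](_ : #|{: vec (\rank M)}| = _); last by rewrite card_mx card_Fp ?mul1n.
rewrite -(card_codom inj); apply: eq_card => v.
apply/idP/codomP => [/BP|] [w ->]; first by exists w.
by apply/BP; exists w.
Qed.

Lemma card_split k :
  (#|[set d : vec n in E | d 0%R k == 0%R]| +
   #|[set d : vec n in E | d 0%R k != 0%R]|)%N = #|E|.
Proof.
rewrite -(cardsID [set d : vec n | d 0 k == 0] E); congr addn;
  apply: eq_card => d; rewrite !inE //.
by rewrite andbC.
Qed.

(** Adding a fixed word that is 1 at [k] injects the words nonzero at [k] into those vanishing
    there. *)
Lemma card_nonzero k : (#|[set d : vec n in E | d 0%R k != 0%R]|.*2 <= #|E|)%N.
Proof.
rewrite -(card_split k) -addnn leq_add2r.
have [->|[e]] := set_0Vmem [set d : vec n in E | d 0 k != 0]; first by rewrite cards0.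
case/setIdP=> Ee ek.
rewrite -(card_imset _ (addIr e)); apply/subset_leq_card/subsetP.
move=> ? /imsetP[d /setIdP[Ed dk] ->].
rewrite !inE ED // mxE; move: dk ek.
by f2_case (d 0 k); f2_case (e 0 k).
Qed.

Lemma sum_wt : (\sum_(d in E) wt d)%N =
  (\sum_k #|[set d : vec n in E | d 0%R k != 0%R]|)%N.
Proof.
transitivity (\sum_(d in E) \sum_k (d 0%R k != 0%R))%N.
  by apply: eq_bigr => d _; exact: wtE.
rewrite exchange_big; apply: eq_bigr => k _.
by rewrite -big_mkcondr sum1dep_card.
Qed.

Lemma sum_wt_ge m : {in E, forall d, d != 0 -> (m <= wt d)%N} ->
  (m * #|E|.-1 <= \sum_(d in E) wt d)%N.
Proof.
move=> minE; rewrite (bigD1 0) //= wt0 add0n (cardsD1 0) E0 /= mulnC -sum_nat_const.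
rewrite [X in (_ <= X)%N](eq_bigl (mem (E :\ 0))) => [|d]; last by rewrite !inE andbC.
by apply: leq_sum => d /setD1P[d0 Ed]; exact: minE.
Qed.

End LinearCode.

Section Code16.
Variable D : {set vec 16}.
Hypothesis D0 : 0 \in D.
Hypothesis DD : {in D &, forall x y, x + y \in D}.
Hypothesis minD : {in D, forall d, d != 0 -> (8 <= wt d)%N}.
Hypothesis cardD_ge : (32 <= #|D|)%N.

Let sub (j : 'I_16) : {set vec 16} := [set d : vec 16 in D | d 0 j == 0].

Let sub0 j : 0 \in sub j. Proof. by rewrite !inE D0 mxE eqxx. Qed.

Let subD j : {in sub j &, forall x y, x + y \in sub j}.
Proof.
move=> x y /setIdP[Dx xj] /setIdP[Dy yj].
by rewrite !inE DD // mxE (eqP xj) (eqP yj) addr0 eqxx.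
Qed.

Let min_sub j : {in sub j, forall d, d != 0 -> (8 <= wt d)%N}.
Proof. by move=> d /setIdP[Dd _]; exact: minD. Qed.

(** The averaging half of Plotkin's bound: a coordinate in [Z] contributes nothing to the total
    weight, any other at most half of the words. *)
Let sub_zeros j (Z : {set 'I_16}) : (forall k d, k \in Z -> d \in sub j -> d 0 k = 0) ->
  ((\sum_(d in sub j) wt d).*2 <= (16 - #|Z|) * #|sub j|)%N.
Proof.
move=> Z0; rewrite sum_wt (bigID (mem Z)) /= big1 => [|k Zk]; last first.
  apply/eqP; rewrite cards_eq0 -subset0; apply/subsetP => d /setIdP[Dd].
  by rewrite (Z0 k) ?eqxx.
rewrite add0n -mul2n big_distrr /=.
have -> : (16 - #|Z| = #|~: Z|)%N by rewrite [RHS]cardsCs setCK card_ord.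
rewrite -sum_nat_const [X in (_ <= X)%N](eq_bigl (fun k => k \notin Z)) => [|k].
  by apply: leq_sum => k _; rewrite mul2n card_nonzero.
by rewrite inE.
Qed.

Let sub_wt j : ((\sum_(d in sub j) wt d).*2 <= 15 * #|sub j|)%N.
Proof.
have := @sub_zeros j [set j]; rewrite cards1; apply=> k d /set1P-> /setIdP[_].
by move/eqP.
Qed.

(** With N words, the total weight S satisfies 8(N - 1) <= S and 2S <= 15N, whence N <= 16. *)
Let card_sub_le j : (#|sub j| <= 16)%N.
Proof.
have := sum_wt_ge (sub0 j) (@min_sub j); have := sub_wt j.
by lia.
Qed.

Let card_sub_half j : (#|D| <= #|sub j|.*2)%N.
Proof.
by have := card_nonzero DD j; rewrite -(card_split D j) -!addnn leq_add2r leq_add2l.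
Qed.

Lemma card_code16 : #|D| = 32%N.
Proof. by have := card_sub_le 0; have := card_sub_half 0; lia. Qed.

Let card_sub j : #|sub j| = 16%N.
Proof. by have := card_sub_le j; have := card_sub_half j; rewrite card_code16; lia. Qed.

(** Equality in Plotkin's bound: 15 nonzero words of weight at least 8 share a total weight of at
    most 120. *)
Let wt8 j d : d \in sub j -> d != 0 -> wt d = 8%N.
Proof.
move=> Sd d0; apply/eqP; rewrite eqn_leq (min_sub Sd) // andbT.
have S0 := sub0 j; have := sub_wt j; rewrite card_sub (bigD1 d) //= (bigD1 0) /=; last first.
  by rewrite S0 eq_sym.
rewrite wt0 add0n.
set T := (sub j :\ d) :\ 0.
have cT : #|T| = 14%N.
  have := cardsD1 d (sub j); have := cardsD1 0 (sub j :\ d).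
  have -> : 0 \in sub j :\ d by rewrite in_setD1 eq_sym d0 S0.
  by rewrite -/T card_sub Sd => -> [].
have : (#|T| * 8 <= \sum_(i | (i \in sub j) && (i != d) && (i != 0%R)) wt i)%N.
  rewrite -sum_nat_const [X in (_ <= X)%N](eq_bigl (mem T)) => [|i].
    by apply: leq_sum => i /setD1P[i0 /setD1P[_ Si]]; exact: min_sub Si i0.
  by rewrite /= !in_setD1; case: (i \in sub j); case: (i == d); case: (i == 0).
by rewrite cT; move: (\sum_(_ | _) _)%N => S; lia.
Qed.

(** If all words vanishing at [j] also vanished at [k], only 14 coordinates would carry weight:
    twice the total is at least 240 but at most 14 * 16 = 224. *)
Let separated j k : j != k -> exists2 d, d \in sub j & d 0 k != 0.
Proof.
move=> jk; apply/exists_inP; apply: contraT => /exists_inPn Sk.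
have := @sub_zeros j [set j; k]; rewrite cards2 jk => /(_ _)/wrap[].
  move=> l d /set2P[]-> Sd; last by apply/eqP; move: (Sk d Sd); rewrite negbK.
  by case/setIdP: Sd => _ /eqP.
by have := sum_wt_ge (sub0 j) (@min_sub j); rewrite card_sub; lia.
Qed.

(** Otherwise every word has a zero coordinate, so the 31 nonzero words have weight 8 and total
    weight 248. Counting by coordinates gives 16 * 16 = 256. *)
Lemma const1_code16 : const_mx 1 \in D.
Proof.
apply: contraT => D1.
have Dzero d : d \in D -> exists j, d \in sub j.
  move=> Dd; apply/existsP; apply: contraR D1 => /existsPn nS.
  suff <- : d = const_mx 1 by [].
  apply/rowP => j; move: (nS j); rewrite !inE Dd mxE /=.
  by f2_case (d 0 j).
have s256 : (\sum_(d in D) wt d = 256)%N.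
  rewrite sum_wt (eq_bigr (fun _ => 16%N)) ?sum_nat_const ?card_ord // => j _.
  by have := card_split D j; rewrite -/(sub j) card_sub card_code16; lia.
have := cardsD1 0 D; rewrite D0 card_code16 add1n.
move: s256; rewrite (bigD1 0) //= wt0 add0n.
rewrite (eq_bigr (fun _ => 8%N)) => [|d /andP[Dd d0]]; last first.
  by have [j Sd] := Dzero d Dd; exact: wt8 Sd d0.
rewrite (eq_bigl (mem (D :\ 0))) => [|d]; last by rewrite !inE andbC.
by rewrite sum_nat_const => + [c31]; rewrite -c31.
Qed.

(** The columns of a generator matrix of the 16 words vanishing at coordinate 0 label the
    coordinates by distinct points of F_2^4. Those words become the linear functions, and the
    all-one word supplies the constants. *)
Lemma code16_rm14 : exists s : {perm 'I_16}, s 0 = 0 /\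
  forall v, (bits v \in rm14) = (col_perm s v \in D).
Proof.
have [r [A [cA AP]]] := linear_basis (sub0 0) (@subD 0).
have r4 : r = 4%N by apply: (@expnI 2); rewrite // -cA card_sub.
subst r; pose t k j := A (inord k) j != 0.
have lt16 (a b c d : bool) : (a + b.*2 + c * 4 + d * 8 < 16)%N.
  by case: a; case: b; case: c; case: d.
(* The label of coordinate [j]: the number whose binary digits form column [j] of [A]. *)
pose f j := Ordinal (lt16 (t 0 j) (t 1 j) (t 2 j) (t 3 j)).
have rowA k : row k A \in sub 0 by apply/AP; exists (delta_mx 0 k); rewrite rowE.
have f_inj : injective f.
  move=> j k E; apply/eqP; apply: contraT => jk; have [d Sd dk] := separated jk.
  have tE l i : (i < 4)%N ->
      t i l = nth false (affine (set_nth false (nseq 5 false) i.+1 true)) (f l).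
    by case: i => [|[|[|[|i]]]] // _; rewrite affineP /= ?addbF.
  have tA i : A i j = A i k.
    by apply: F2_eqb; have := tE k i (ltn_ord i); rewrite -E -tE // /t inord_val.
  have Ejk e : e \in sub 0 -> e 0 j = e 0 k.
    by case/AP => w ->; rewrite !mxE; apply: eq_bigr => i _; rewrite tA.
  have [Dd /eqP dj] := setIdP Sd.
  (* The separating word may be 1 at coordinate 0. Adding the all-one word then brings it into
     [sub 0], where equal columns force equal values. *)
  have [d0|d0] := F2P (d 0 0).
    by move: dk; rewrite -Ejk ?dj ?eqxx // inE Dd d0 eqxx.
  have /Ejk : d + const_mx 1 \in sub 0.
    by rewrite inE DD ?const1_code16 //= !mxE d0.
  rewrite !mxE dj; move: dk; by f2_case (d 0 k).
exists (perm f_inj); split.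
  apply: val_inj; rewrite permE /=.
  have t0 k : t k 0 = false.
    rewrite /t; have := rowA (inord k); rewrite !inE mxE => /andP[_ /eqP->].
    by rewrite eqxx.
  by rewrite !t0.
pose a (c : 'F_2) (w : vec 4) := [:: c != 0; w 0 (inord 0) != 0; w 0 (inord 1) != 0;
                            w 0 (inord 2) != 0; w 0 (inord 3) != 0].
have entry (c : 'F_2) w j :
    ((const_mx c + w *m A) 0 j != 0) = nth false (affine (a c w)) (f j).
  rewrite affineP !mxE (eq_bigr (fun k : 'I_4 => w 0 (inord k) * A (inord k) j)) => [|k _].
    by rewrite 4!big_ord_recr big_ord0 /= add0r !F2_addb !mulf_eq0 !negb_or !addbA.
  by rewrite inord_val.
have key c w v :
    bits v = affine (a c w) <-> col_perm (perm f_inj) v = const_mx c + w *m A.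
  split=> [Ev | Ev].
    by apply/rowP => j; apply: F2_eqb; rewrite entry -Ev mxE permE nth_bits.
  apply: bitsP => // p; rewrite -[p](permKV (perm f_inj)) [perm f_inj _]permE -entry.
  by rewrite -Ev mxE -[f _](permE f_inj).
move=> v; apply/mapP/idP => [[b /size_words]|Dv].
  case: b => [|c [|b0 [|b1 [|b2 [|b3 [|]]]]]] // _ Ev.
  pose w : vec 4 := \row_k (nth false [:: b0; b1; b2; b3] k)%:R.
  have -> : col_perm (perm f_inj) v = const_mx c%:R + w *m A.
    apply/key; rewrite Ev /a !mxE !inordK //=.
    by case: (c); case: (b0); case: (b1); case: (b2); case: (b3).
  apply: DD; last by have /setIdP[] : w *m A \in sub 0 by apply/AP; exists w.
  case: (c); first exact: const1_code16.
  by rewrite (_ : const_mx _ = 0) //; apply/rowP => k; rewrite !mxE.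
(* Adding the constant equal to the value at coordinate 0 brings the word into [sub 0]. *)
pose c := col_perm (perm f_inj) v 0 0.
have /AP[w Ew] : const_mx c + col_perm (perm f_inj) v \in sub 0.
  rewrite inE; apply/andP; split; last by rewrite mxE [const_mx _ _ _]mxE -/c; f2_case c.
  apply: DD => //; have [->|->] := F2P c; last exact: const1_code16.
  by rewrite (_ : const_mx _ = 0) //; apply/rowP => k; rewrite !mxE.
exists (a c w); first exact: mem_words.
by apply/key; rewrite -Ew addF2Kl.
Qed.

End Code16.

(** * Quadratic forms and Kerdock sets *)

Definition zero_form : seq bool := nseq 6 false.

(** Slot 0 of a coefficient list is the constant term, hence the index [k.+1] for x_k. *)
Definition coordv (k : nat) : seq bool := affine (set_nth false (nseq 5 false) k.+1 true).

(* [a] lists the coefficients of x0x1, x0x2, x1x2, x0x3, x1x3, x2x3. *)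
Definition quad (a : seq bool) : seq bool :=
  foldr (fun t v => if t.1
      then xorv [seq p.1 && p.2 | p <- zip (coordv t.2.1) (coordv t.2.2)] v else v)
    (nseq 16 false)
    (zip a [:: (0, 1); (0, 2); (1, 2); (0, 3); (1, 3); (2, 3)]%N).

(* The form [quad a] is bent exactly when its alternating matrix is nonsingular. *)
Definition pfaffian (a : seq bool) : bool :=
  let c := nth false a in
  (c 0 && c 5) (+) (c 1 && c 4) (+) (c 2 && c 3).

(* A quadratic form takes its coefficient of x_i x_j as value at 2^i + 2^j. *)
Definition coeffs (v : seq bool) : seq bool :=
  [seq nth false v p | p <- [:: 3; 5; 6; 9; 10; 12]]%N.

(* The affine function agreeing with [v] at 0 and at the four unit vectors. *)
Definition affine_part (v : seq bool) : seq bool :=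
  affine (head false v :: [seq head false v (+) nth false v p | p <- [:: 1; 2; 4; 8]%N]).

Definition kerdock_base : seq (seq bool) :=
  [seq [seq (0 < n)%N | n <- a] | a <-
    [:: [:: 0; 0; 1; 1; 0; 0]; [:: 0; 1; 0; 1; 1; 0]; [:: 0; 1; 1; 0; 1; 1];
        [:: 1; 0; 0; 1; 1; 1]; [:: 1; 0; 1; 0; 0; 1]; [:: 1; 1; 0; 1; 0; 1];
        [:: 1; 1; 1; 0; 1; 0]]%N].

(* The linear map fixing 1, 2, 4 and sending 8 to 8 + k. *)
Definition twist (k : nat) : seq nat :=
  iota 0 8 ++ [seq (8 + Nat.lxor k p)%N | p <- iota 0 8].

(** [coeffs] reads off a form correctly only once the affine part is removed. *)
Definition kerdock (k : nat) : seq (seq bool) :=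
  [seq coeffs (xorv w (affine_part w)) |
    w <- [seq permv (twist k) (quad a) | a <- kerdock_base]].

(** The Nordstrom-Robinson code as a union of eight cosets of RM(1,4). *)
Definition nr_std : seq (seq bool) :=
  [seq xorv (quad a) r | a <- zero_form :: kerdock_base, r <- rm14].

(* Inserts zeros at the positions 0, 1, 2, 4, 8, where every coset of RM(1,4) has
   exactly one word vanishing. *)
Definition place (w : seq bool) : seq bool :=
  [:: false, false, false, nth false w 0, false & take 3 (behead w)] ++ false :: drop 4 w.

Definition far_from_rm14 (v : seq bool) : bool :=
  all (fun r => 6 <= wtv (xorv v r))%N rm14.

Definition nonsingular : seq (seq bool) := [seq a <- words 6 | pfaffian a].

(** Bent functions in four variables are quadratic; normalization leaves 2^11 words to test. *)
Lemma bent_check : let bents := map quad nonsingular in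
  all (fun v => v \in bents) [seq v <- map place (words 11) | far_from_rm14 v].
Proof. by vm_compute. Qed.

Lemma coeffs_quad_check : all (fun a => coeffs (quad a) == a) (words 6).
Proof. by vm_compute. Qed.

(* In terms of the action of GL(4,2) = A_8 on 8 letters, nonsingular forms are pairs
   of letters, adjacent when they meet, and Kerdock sets are the 7 pairs through
   one letter: besides those, only a + b is adjacent to adjacent a and b. *)
Lemma kerdock_check : let forms := nonsingular in let kerdocks := map kerdock (iota 0 8) in
  let neighbours a := [seq b <- forms | pfaffian (xorv a b)] in
  all (fun a => all (fun b =>
    has (fun K => [&& a \in K, b \in K &
      all (fun c => ((c \in K) || (c == xorv a b)) && ~~ pfaffian (xorv (xorv a b) c))
        [seq c <- neighbours a | pfaffian (xorv b c)]]) kerdocks)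
    (neighbours a)) forms.
Proof. by vm_compute. Qed.

(** A linear change of variables preserves RM(1,4), so the twisted code is again made of cosets of
    RM(1,4), now represented by [kerdock k] and 0. *)
Lemma twist_check :
  all (fun k => let quads := [seq quad a | a <- zero_form :: kerdock k] in
    all (fun w => xorv w (affine_part w) \in quads) (map (permv (twist k)) nr_std)) (iota 0 8).
Proof. by vm_compute. Qed.

Lemma twist_perm_check : all (fun k => perm_eq (twist k) (iota 0 16)) (iota 0 8).
Proof. by vm_compute. Qed.

Lemma nr_std_uniq : uniq nr_std.
Proof. by vm_compute. Qed.

Lemma size_nr_std : all (fun w => size w == 16)%N nr_std && (size nr_std == 256)%N.
Proof. by vm_compute. Qed.

(** * Coordinate permutations and words modulo RM(1,4) *)

Lemma wt_col_perm n (s : {perm 'I_n}) (x : vec n) : wt (col_perm s x) = wt x.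
Proof.
rewrite !wtE [RHS](reindex_inj (@perm_inj _ s)); apply: eq_bigr => i _.
by rewrite mxE.
Qed.

Lemma col_permK n (s : {perm 'I_n}) : cancel (col_perm s) (@col_perm 'F_2 1 n s^-1).
Proof. by move=> x; rewrite -col_permM mulVg col_perm1. Qed.

Lemma col_permKV n (s : {perm 'I_n}) : cancel (col_perm s^-1) (@col_perm 'F_2 1 n s).
Proof. by move=> x; rewrite -col_permM mulgV col_perm1. Qed.

Lemma wt_delta2 n (i j : 'I_n) : i != j -> wt (delta_mx 0 i + delta_mx 0 j : vec n) = 2%N.
Proof.
move=> ij; rewrite /wt (_ : [set _ | _] = [set i; j]) ?cards2 ?ij //.
apply/setP => k; rewrite !inE !mxE eqxx /= F2_addb.
by have [->|] := eqVneq k i; [rewrite (negPf ij) | case: (k == j)].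
Qed.

Definition unbits n (v : seq bool) : vec n := \row_i (nth false v i)%:R.

Lemma unbitsK n v : size v = n -> bits (unbits n v) = v.
Proof. by move=> sv; apply: bitsP => // i; rewrite mxE; case: nth. Qed.

Lemma card_bits n (s : seq (seq bool)) : uniq s -> all (fun v => size v == n) s ->
  #|[set v : vec n | bits v \in s]| = size s.
Proof.
move=> Us /allP ss; rewrite -(size_map (unbits n)).
have /card_uniqP<- : uniq (map (unbits n) s).
  rewrite map_inj_in_uniq // => v w /ss/eqP sv /ss/eqP sw E.
  by rewrite -(unbitsK sv) -(unbitsK sw) E.
apply: eq_card => v; rewrite inE; apply/idP/mapP => [vs|[w sw ->]].
  by exists (bits v) => //; apply: bits_inj; rewrite unbitsK ?size_bits.
by rewrite unbitsK //; exact/eqP/ss.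
Qed.

Lemma xorvv v : xorv v v = nseq (size v) false.
Proof. by elim: v => //= b v; rewrite /xorv /= addbb => ->. Qed.

Lemma xorvK v w : size v = size w -> xorv (xorv v w) w = v.
Proof.
elim: v w => [|b v IHv] [|c w] //= [sE].
by rewrite /xorv /= in IHv *; rewrite IHv // -addbA addbb addbF.
Qed.

Lemma coeffsD v w : size v = size w -> coeffs (xorv v w) = xorv (coeffs v) (coeffs w).
Proof. by move=> sE; rewrite /coeffs /= !nth_xorv. Qed.

Definition normalized (v : seq bool) := all (fun p => ~~ nth false v p) [:: 0; 1; 2; 4; 8]%N.

Lemma normalizedD v w : size v = size w ->
  normalized v -> normalized w -> normalized (xorv v w).
Proof.
move=> sE /allP nv /allP nw; apply/allP => p Sp; rewrite nth_xorv //.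
by rewrite (negPf (nv p Sp)) (negPf (nw p Sp)).
Qed.

Ltac destruct16 v :=
  case: v => [|? [|? [|? [|? [|? [|? [|? [|? [|? [|? [|? [|? [|? [|? [|? [|? [|? ?]]]]]]]]]]]]]]]]] //.

Lemma normalized_place v : size v = 16%N -> normalized v -> v \in map place (words 11).
Proof.
move=> sv nv; apply/mapP.
exists [seq nth false v p | p <- [:: 3; 5; 6; 7; 9; 10; 11; 12; 13; 14; 15]%N].
  exact: mem_words.
move: sv nv; destruct16 v => _; rewrite /normalized /=.
by do ![case/andP=> /negPf-> | case/andP].
Qed.

Lemma size_affine_part v : size (affine_part v) = 16%N.
Proof. by []. Qed.

Lemma affine_part_rm14 v : affine_part v \in rm14.
Proof. by apply: (map_f affine); exact: mem_words. Qed.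

Lemma normalized_affine_part v : size v = 16%N -> normalized (xorv v (affine_part v)).
Proof.
move=> sv; apply/allP => p; rewrite nth_xorv ?sv // !inE.
have av (i : nat) : nth false v i = nth false v 0 (+) (head false v (+) nth false v i).
  by rewrite addbA -nth0 addbb.
by do ![case/orP] => /eqP->; rewrite [X in X (+) _]av /= -?nth0; do ![case: (nth _ _ _)].
Qed.

Lemma size_rm14 r : r \in rm14 -> size r = 16%N.
Proof. by case/mapP => a /size_words; case: a => [|? [|? [|? [|? [|? [|]]]]]] // _ ->. Qed.

(** Two of the forms lie in a common Kerdock set, which contains every other [b i] unless it is
    their sum. The sum is excluded because it is not adjacent to a fourth form. Seven distinct forms
    then fill the set. *)
Lemma kerdock_choice (b : 'I_7 -> seq bool) :
  (forall i, b i \in nonsingular) ->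
  (forall i j, i != j -> pfaffian (xorv (b i) (b j))) ->
  exists2 k, k \in iota 0 8 & forall a, a \in kerdock k -> exists i, a = b i.
Proof.
move=> bN bA; pose i0 : 'I_7 := inord 0; pose i1 : 'I_7 := inord 1.
have i01 : i0 != i1 by rewrite -val_eqE /= !inordK.
move/allP: kerdock_check => /(_ _ (bN i0))/allP/(_ (b i1)).
rewrite mem_filter bN bA // => /(_ isT)/hasP[K /mapP[k k8 ->] /and3P[b0K b1K /allP cK]].
have {}cK i : i != i0 -> i != i1 ->
    ((b i \in kerdock k) || (b i == xorv (b i0) (b i1))) &&
    ~~ pfaffian (xorv (xorv (b i0) (b i1)) (b i)).
  by move=> i0' i1'; apply: cK; rewrite 2!mem_filter bN !bA // eq_sym.
have bK i : b i \in kerdock k.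
  have [->//|ni0] := eqVneq i i0; have [->//|ni1] := eqVneq i i1.
  have [j [nj0 nj1 nij]] : exists j, [/\ j != i0, j != i1 & i != j].
    have [-> | ni2] := eqVneq i (inord 2); [exists (inord 3) | exists (inord 2)];
      by split; rewrite // -val_eqE /= !inordK.
  case/andP: (cK i ni0 ni1) => /orP[//|/eqP Ei] _.
  by case/andP: (cK j nj0 nj1) => _; rewrite -Ei bA.
exists k => // a aK.
(* A repeated form would have sum zero, whose Pfaffian vanishes. *)
have Ub : uniq (map b (enum 'I_7)).
  rewrite map_inj_in_uniq ?enum_uniq // => i j _ _ Eij; apply: contraTeq isT => /bA.
  move: (bN j); rewrite mem_filter Eij => /andP[_ /size_words sj].
  by rewrite xorvv sj.
have sub : {subset map b (enum 'I_7) <= kerdock k} by move=> _ /mapP[i _ ->].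
have [|_ bE] := uniq_min_size Ub sub; first by rewrite [leqRHS]size_map size_enum_ord.
by move: aK; rewrite -bE => /mapP[i _ ->]; exists i.
Qed.

(* The choice i = ord_max gives the words of D^0. *)
Lemma mem_Dunion (G : {set vec (8 + 16)}) (c : vec (8 + 16)) :
  c \in Dunion G <->
  c \in G /\ exists i : 'I_8, lsubmx c = delta_mx 0 i + delta_mx 0 ord_max.
Proof.
have suppE (k : 'I_8) : (lshift 16 k \in suppJstar c) = (lsubmx c 0 k != 0).
  by rewrite inE mxE /= ltn_ord.
have suppJ k : k \in suppJstar c -> exists j : 'I_8, k = lshift 16 j.
  by rewrite inE => /andP[k8 _]; exists (Ordinal k8); exact: val_inj.
split.
  case/setIdP => Gc suppc; split=> //; case/orP: suppc => [/eqP S0|].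
    exists ord_max; apply/rowP => k; apply: F2_eqb.
    by rewrite -suppE S0 addF2v mxE inE.
  case/existsP => i /andP[i7 /eqP Si]; exists (Ordinal (leq_trans i7 (leqnSn 7))).
  apply/rowP => k; apply: F2_eqb; rewrite -suppE Si !inE !mxE F2_addb eqxx /=.
  rewrite -!val_eqE /= inordK //.
  by have [->|] := eqVneq (k : nat) i; [rewrite (ltn_eqF i7) | case: (k == 7 :> nat)].
case=> Gc [i Ei]; rewrite inE Gc /=.
have Ek (k : 'I_8) : (lshift 16 k \in suppJstar c) = (k == i) (+) (k == ord_max).
  by rewrite suppE Ei !mxE F2_addb eqxx /=; case: (k == i); case: (k == ord_max).
have [i7|i7] := eqVneq i ord_max; apply/orP; [left|right].
  rewrite -subset0; apply/subsetP => k Sk; have [j kj] := suppJ k Sk.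
  by move: Sk; rewrite kj Ek i7 addbb.
have lt7 : (i < 7)%N by rewrite ltn_neqAle i7 -ltnS ltn_ord.
apply/existsP; exists (lshift 16 i); rewrite /= lt7; apply/eqP/setP => k.
apply/idP/set2P => [Sk|].
  have [j kj] := suppJ k Sk; move: Sk; rewrite kj Ek.
  have [->|_ /eqP->] := eqVneq j i; [by left | right].
  by apply: val_inj; rewrite /= inordK.
have -> : inord 7 = lshift 16 (ord_max : 'I_8) by apply: val_inj; rewrite /= inordK.
by case=> ->; rewrite Ek eqxx ?(negPf i7) // eq_sym (negPf i7).
Qed.

(** * Golay codes containing the octad J* *)

Ltac wt_lia := repeat (let w := fresh "w" in move: (wt _) => w); lia.

Section Golay.
Variable G : {set vec (8 + 16)}.
Hypothesis G0 : 0 \in G.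
Hypothesis GD : {in G &, forall x y, x + y \in G}.
Hypothesis cardG : #|G| = (2 ^ 12)%N.
Hypothesis minG : {in G, forall x, x != 0 -> (8 <= wt x)%N}.
Hypothesis G1 : row_mx (const_mx 1) 0 \in G.

Local Notation e i := (delta_mx 0 i : vec 16).

Lemma wt_split (c : vec (8 + 16)) : wt c = (wt (lsubmx c) + wt (rsubmx c))%N.
Proof. by rewrite -wt_row_mx hsubmxK. Qed.

(** The minimum weight 8 is applied to [c] and to the sum of [c] with the octad J*. *)
Lemma golay_min_sub c : c \in G -> rsubmx c != 0 ->
  (wt (lsubmx c) <= wt (rsubmx c))%N /\ (8 - wt (rsubmx c) <= wt (lsubmx c))%N.
Proof.
move=> Gc uc; split; last first.
  have c0 : c != 0 by apply: contraNneq uc => ->; rewrite linear0.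
  have := minG Gc c0; rewrite wt_split. wt_lia.
have c0 : row_mx (const_mx 1) 0 + c != 0.
  apply: contraNneq uc => /(congr1 rsubmx).
  by rewrite linearD linear0 /= row_mxKr add0r => ->.
have := minG (GD G1 Gc) c0; have := wt_const1D (lsubmx c).
rewrite wt_split !linearD /= row_mxKl row_mxKr add0r.
wt_lia.
Qed.

Lemma golay_sub0 c : c \in G -> rsubmx c = 0 -> lsubmx c = 0 \/ lsubmx c = const_mx 1.
Proof.
move=> Gc uc; have [->|xc] := eqVneq (lsubmx c) 0; [by left|right].
have wt8 : (8 <= wt (lsubmx c))%N.
  have := minG Gc; rewrite wt_split uc wt0 addn0; apply.
  by apply: contraNneq xc => ->; rewrite linear0.
apply/esym/addF2_eq0/eqP; rewrite -wt_eq0.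
by move: wt8 (wt_const1D (lsubmx c)); wt_lia.
Qed.

(** For a nonzero restriction of weight w, the two bounds give 8 - w <= w. *)
Lemma golay_sub_lt4 c : c \in G -> (wt (rsubmx c) < 4)%N -> rsubmx c = 0.
Proof.
move=> Gc lt4; apply/eqP; apply: contraLR lt4 => uc.
by have [] := golay_min_sub Gc uc; wt_lia.
Qed.

Lemma golay_sub0_even c : c \in G -> rsubmx c = 0 -> ~~ odd (wt (lsubmx c)).
Proof.
move=> Gc /(golay_sub0 Gc)[] ->; rewrite ?wt0 //.
by have := wt_const1D (0 : vec 8); rewrite addr0 wt0 addn0 => ->.
Qed.

Lemma golay_sub_le4_even c : c \in G -> (wt (rsubmx c) <= 4)%N -> ~~ odd (wt (lsubmx c)).
Proof.
move=> Gc le4; have [uc|uc] := eqVneq (rsubmx c) 0; first exact: golay_sub0_even.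
suff -> : wt (lsubmx c) = 4%N by [].
by move: le4; have [] := golay_min_sub Gc uc; wt_lia.
Qed.

(* The words of G restricted to J form a [16,11,4] code, for which the 32
   cosets of the words e l and e l + e i, for a fixed i, exhaust the space. *)
Lemma golay_cover (i : 'I_16) (y : vec 16) :
  exists c l (b : bool), c \in G /\ rsubmx c + e l + (if b then e i else 0) = y.
Proof.
(* The extra bit tells apart the two words of G with the same restriction, which differ by the
   octad. Then [f] is an injection between sets of size 2^17. *)
pose f (z : vec (8 + 16) * 'I_16 * bool) : vec 16 * 'F_2 :=
  (rsubmx z.1.1 + e z.1.2 + (if z.2 then e i else 0), lsubmx z.1.1 0 0).
pose A := setX (setX G [set: 'I_16]) [set: bool].
have f_inj : {in A &, injective f}.
  move=> [[c l] b] [[c' l'] b']; rewrite !inE /= !andbT => Gc Gc' [Eu Ex].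
  have Gcc := GD Gc Gc'.
  have Eu' : rsubmx (c + c') = e l + e l' + (if b (+) b' then e i else 0).
    rewrite linearD /=.
    have -> : rsubmx c' = rsubmx c + e l + (if b then e i else 0) +
        (if b' then e i else 0) + e l'.
      by rewrite Eu !addF2K.
    have -> : (if b (+) b' then e i else 0) =
        (if b then e i else 0) + (if b' then e i else 0).
      by case: (b); case: (b'); rewrite /= ?addF2v ?addr0 ?add0r.
    by rewrite -!addrA addF2Kl; congr (_ + _); rewrite [RHS]addrC -addrA.
  have u0 : rsubmx (c + c') = 0.
    apply: golay_sub_lt4 => //; rewrite Eu'.
    apply: leq_ltn_trans (leq_wtD _ _) _.
    have := leq_wtD (e l) (e l'); rewrite !wt_delta.
    by case: ifP => _; rewrite ?wt_delta ?wt0; wt_lia.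
  have Eb : b = b'.
    have := congr1 (fun v => odd (wt v)) Eu'; rewrite u0 !odd_wtD !wt_delta wt0 /=.
    by case: (b); case: (b') => //=; rewrite wt_delta.
  have El : l = l'.
    move: Eu'; rewrite u0 Eb addbb addr0 => /esym/addF2_eq0/rowP/(_ l).
    by rewrite !mxE !eqxx /=; case: eqP.
  have Ec : c = c'.
    apply: addF2_eq0; rewrite -[LHS]hsubmxK u0.
    case: (golay_sub0 Gcc u0) => [->|E]; first by rewrite row_mx0.
    move/rowP/(_ 0): E; rewrite linearD mxE /= Ex [in RHS]mxE.
    by f2_case (lsubmx c' 0 0).
  by rewrite Eb El Ec.
have cA : #|A| = (2 ^ 17)%N.
  by rewrite !cardsX cardG cardsT card_ord cardsT card_bool.
have : (y, 0) \in f @: A.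
  rewrite (_ : f @: A = setT) ?inE //.
  apply/eqP; rewrite eqEcard subsetT card_in_imset // cA cardsT card_prod.
  by rewrite card_mx card_Fp.
case/imsetP => [[[c l] b]]; rewrite !inE /= !andbT => Gc [Ey _].
by exists c, l, b.
Qed.

(** Cover [e i + e j + e k]. If the cover used [e i], the restriction would be a sum of three unit
    vectors, hence of odd weight below 4, which is impossible. *)
Lemma golay_quad i j k :
  exists c l, c \in G /\ rsubmx c = e i + e j + e k + e l.
Proof.
have [c [l [b [Gc]]]] := golay_cover i (e i + e j + e k); case: b => [E|].
  have Eu : rsubmx c = e j + e k + e l.
    move/(congr1 (fun v => v + e i + e l)): E; rewrite addF2K addF2K => ->.
    by rewrite -2![e i + _ + _]addrA [e i + _]addrC addF2K.
  have u0 : rsubmx c = 0.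
    apply: golay_sub_lt4 => //; rewrite Eu.
    apply: leq_ltn_trans (leq_wtD _ _) _.
    by have := leq_wtD (e j) (e k); rewrite !wt_delta; wt_lia.
  by have := congr1 (fun v => odd (wt v)) Eu; rewrite u0 !odd_wtD !wt_delta wt0.
by rewrite addr0 => E; exists c, l; rewrite -E addF2K.
Qed.

(** Reduces an odd sum of unit vectors to a single one, three to one at each step, by words with
    restriction of weight at most 4; these meet J* evenly. *)
Lemma golay_odd_cover n (s : seq 'I_16) : size s = n.*2.+1 ->
  exists c l, [/\ c \in G, rsubmx c = \sum_(i <- s) e i + e l & ~~ odd (wt (lsubmx c))].
Proof.
elim: n s => [|n IHn] [|i s] //=.
  case: s => // _; exists 0, i.
  by rewrite big_seq1 addF2v !linear0 wt0.
case: s => // j s [sz]; have [c [l [Gc Ec oc]]] := IHn s sz.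
have [d [k [Gd Ed]]] := golay_quad i j l.
have od : ~~ odd (wt (lsubmx d)).
  apply: golay_sub_le4_even => //; rewrite Ed.
  have := leq_wtD (e i + e j + e l) (e k); have := leq_wtD (e i + e j) (e l).
  by have := leq_wtD (e i) (e j); rewrite !wt_delta; wt_lia.
exists (c + d), k; rewrite !linearD odd_wtD (negPf oc) GD //; split=> //=.
rewrite Ec Ed !big_cons; move: (\sum_(_ <- s) _) (e i) (e j) (e l) (e k).
move=> v1 v2 v3 v4 v5; rewrite -[RHS](addF2K _ v4).
by apply/rowP => t; rewrite !mxE; ring.
Qed.

(** An odd restriction would reduce to weight 1, which is impossible. An even one reduces to weight
    at most 2 modulo words meeting J* evenly. *)
Lemma golay_even c : c \in G -> ~~ odd (wt (lsubmx c)).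
Proof.
move=> Gc; set s := enum [set i | rsubmx c 0 i != 0].
have sz_s : size s = wt (rsubmx c) by rewrite -cardE.
have us : rsubmx c = \sum_(i <- s) e i := sum_delta (rsubmx c).
have [oc|] := boolP (odd (wt (rsubmx c))).
  have [|d [l [Gd Ed od]]] := @golay_odd_cover (wt (rsubmx c))./2 s.
    by rewrite sz_s -[LHS]odd_double_half oc.
  suff : wt (rsubmx (c + d)) = 1%N.
    move=> w1; have := golay_sub_lt4 (GD Gc Gd); rewrite w1 => /(_ isT) u0.
    by move: w1; rewrite u0 wt0.
  by rewrite linearD /= Ed -us addF2Kl wt_delta.
(* The extra coordinate 0 makes the number of summands odd; it may repeat an element of [s]. *)
move=> ec; have [|d [l [Gd Ed od]]] := @golay_odd_cover (wt (rsubmx c))./2 (0 :: s).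
  by rewrite /= sz_s -[X in X.+1]odd_double_half (negPf ec).
rewrite -[c](addF2K _ d) linearD odd_wtD (negPf od) addbF.
apply: golay_sub_le4_even; first exact: GD.
rewrite linearD /= Ed big_cons -us [_ + rsubmx c]addrC -addrA addF2Kl.
by apply: leq_trans (leq_wtD _ _) _; rewrite !wt_delta.
Qed.

(** * The shortened code on J and the structure of NR(G) *)

Definition shortened : {set vec 16} := [set v | row_mx 0 v \in G].

Lemma shortened0 : 0 \in shortened.
Proof. by rewrite inE row_mx0. Qed.

Lemma shortenedD : {in shortened &, forall v w, v + w \in shortened}.
Proof.
move=> v w; rewrite !inE => Gv Gw.
by have := GD Gv Gw; rewrite add_row_mx addr0.
Qed.

Lemma shortened_min : {in shortened, forall v, v != 0 -> (8 <= wt v)%N}.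
Proof.
move=> v; rewrite inE => Gv v0; have [|_] := golay_min_sub Gv; first by rewrite row_mxKr.
by rewrite row_mxKl row_mxKr wt0; wt_lia.
Qed.

Definition even_words : {set vec 8} := [set v | ~~ odd (wt v)].

(** Parity recovers the first bit from the other seven. *)
Lemma card_even_words : (#|even_words| <= 128)%N.
Proof.
pose f (v : vec (1 + 7)) := rsubmx v.
have f_inj : {in even_words &, injective f}.
  move=> v w; rewrite !inE => ev ew /= fvw.
  apply/addF2_eq0/eqP; rewrite -wt_eq0.
  have : odd (wt (v + w)) = false by rewrite odd_wtD (negPf ev) (negPf ew).
  have -> : wt (v + w) = (wt (lsubmx (v + w : vec (1 + 7))))%N.
    rewrite -[in LHS](hsubmxK (v + w : vec (1 + 7))) (@wt_row_mx 1 7).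
    have -> : rsubmx (v + w : vec (1 + 7)) = 0.
      by rewrite linearD /=; move: fvw; rewrite /f => ->; rewrite addF2v.
    by rewrite wt0 addn0.
  rewrite !wtE big_ord1; by case: (_ != 0).
rewrite -(card_in_imset f_inj) -[128%N](_ : #|{: vec 7}| = _) ?max_card //.
by rewrite card_mx card_Fp.
Qed.

(** Adding one fixed word of the fibre maps the fibre injectively into the shortened code. *)
Lemma golay_fiber v : (#|[set c in G | lsubmx c == v]| <= #|shortened|)%N.
Proof.
have [->|[c0]] := set_0Vmem [set c in G | lsubmx c == v]; first by rewrite cards0.
rewrite inE => /andP[Gc0 /eqP Ev].
have inj : {in [set c in G | lsubmx c == v] &, injective (fun c => rsubmx (c + c0))}.
  move=> c d; rewrite !inE => /andP[_ /eqP Ec] /andP[_ /eqP Ed].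
  rewrite !linearD => /addIr E.
  by rewrite -[c]hsubmxK -[d]hsubmxK Ec Ed E.
rewrite -(card_in_imset inj); apply/subset_leq_card/subsetP.
move=> ? /imsetP[c /setIdP[Gc /eqP Ec] ->].
rewrite inE.
rewrite (_ : row_mx _ _ = c + c0) ?GD // -[RHS]hsubmxK; congr row_mx.
by rewrite linearD /= Ec Ev addF2v.
Qed.

Lemma golay_card_image : (2 ^ 12 <= #|lsubmx @: G| * #|shortened|)%N.
Proof.
rewrite -cardG -sum1_card (partition_big_imset lsubmx) /= -sum_nat_const.
apply: leq_sum => v _; apply: leq_trans (golay_fiber v).
by rewrite sum1dep_card.
Qed.

Lemma golay_image_even : lsubmx @: G \subset even_words.
Proof. by apply/subsetP => _ /imsetP[c Gc ->]; rewrite inE golay_even. Qed.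

Lemma card_shortened_ge : (32 <= #|shortened|)%N.
Proof.
have := leq_trans (subset_leq_card golay_image_even) card_even_words.
by move: golay_card_image; move: #|_ @: _| #|shortened| => a b; nia.
Qed.

(** If the fibres have at most 32 words, the 2^12 words need at least 128 prefixes, hence all the
    even ones. *)
Lemma golay_prefix v : #|shortened| = 32%N -> ~~ odd (wt v) ->
  exists2 c, c \in G & lsubmx c = v.
Proof.
move=> c32 ev; suff: v \in lsubmx @: G by case/imsetP => c Gc ->; exists c.
suff -> : lsubmx @: G = even_words by rewrite inE.
apply/eqP; rewrite eqEcard golay_image_even (leq_trans card_even_words) //.
move: golay_card_image; rewrite c32; move: #|_ @: _| => a.
by lia.
Qed.

Local Notation prefix i := (delta_mx 0 (i : 'I_8) + delta_mx 0 (ord_max : 'I_8) : vec 8).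
Let card_S : #|shortened| = 32%N.
Proof.
exact: card_code16 shortened0 shortenedD shortened_min card_shortened_ge.
Qed.

Lemma card_Dunion : (#|Dunion G| <= 256)%N.
Proof.
apply: (@leq_trans (\sum_(i < 8) #|[set c in G | lsubmx c == prefix i]|)%N).
  apply: (@leq_trans #|\bigcup_(i < 8) [set c in G | lsubmx c == prefix i]|).
    apply/subset_leq_card/subsetP => c /mem_Dunion[Gc [i Ei]].
    by apply/bigcupP; exists i; rewrite // inE Gc Ei eqxx.
  elim/big_rec2: _ => [|i m A _ le_Am]; first by rewrite cards0.
  by apply: leq_trans (leq_card_setU _ _) _; rewrite leq_add2l.
have -> : (256 = \sum_(i < 8) #|shortened|)%N by rewrite sum_nat_const card_ord card_S.
by apply: leq_sum => i _; exact: golay_fiber.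
Qed.

(** Labels J so that the shortened code is RM(1,4), identifies the seven bent cosets with some
    [kerdock k], and undoes the twist. The condition [p 0 = 0] keeps the coordinate to be punctured
    in place. *)
Lemma golay_NR : exists p : {perm 'I_16}, p 0 = 0 /\
  NR G = [set col_perm p v | v : vec 16 in [set v | bits v \in nr_std]].
Proof.
have [s [s0 sP]] := code16_rm14 shortened0 shortenedD shortened_min card_shortened_ge.
pose v (c : vec (8 + 16)) : vec 16 := col_perm s^-1 (rsubmx c).
have vK c : col_perm s (v c) = rsubmx c by exact: col_permKV.
have vD c d : bits (v (c + d)) = xorv (bits (v c)) (bits (v d)).
  by rewrite -bitsD; congr bits; apply/rowP => i; rewrite !mxE.
have coset c r : c \in G -> r \in rm14 ->
    exists d, [/\ d \in G, lsubmx d = lsubmx c & bits (v d) = xorv (bits (v c)) r].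
  move=> Gc Rr; have [y yr] := bits_onto (size_rm14 Rr).
  have Gy : row_mx 0 (col_perm s y) \in G by move: Rr; rewrite -yr sP inE.
  exists (c + row_mx 0 (col_perm s y)); split; first exact: GD.
    by rewrite linearD /= row_mxKl addr0.
  by rewrite vD {2}/v row_mxKr col_permK yr.
(* The coset words have weight at least 8 in G, of which 2 lies on J*. *)
have far c : c \in G -> wt (lsubmx c) = 2%N -> far_from_rm14 (bits (v c)).
  move=> Gc c2; apply/allP => r /(coset c r Gc)[d [Gd Ed <-]].
  have d0 : d != 0 by apply: contra_eq_neq c2 => d0; rewrite -Ed d0 linear0 wt0.
  rewrite wt_bits wt_col_perm; move: (minG Gd d0).
  by rewrite -[d in wt d]hsubmxK wt_row_mx Ed c2.
have bent c : c \in G -> wt (lsubmx c) = 2%N -> normalized (bits (v c)) ->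
    exists2 a, a \in nonsingular & bits (v c) = quad a.
  move=> Gc c2 nc; have : bits (v c) \in map quad nonsingular.
    apply: (allP bent_check); rewrite mem_filter far //=.
    by rewrite normalized_place ?size_bits.
  by case/mapP => a aN ->; exists a.
have quadK a : a \in words 6 -> coeffs (quad a) = a.
  by move/(allP coeffs_quad_check)/eqP.
have wt_prefix (i : 'I_7) : wt (prefix (widen_ord (leqnSn 7) i)) = 2%N.
  by apply: wt_delta2; rewrite -val_eqE /= ltn_eqF.
have reps (i : 'I_7) : exists c, [/\ c \in G, lsubmx c = prefix (widen_ord (leqnSn 7) i)
    & normalized (bits (v c))].
  have [|c Gc Ec] := golay_prefix card_S (v := prefix (widen_ord (leqnSn 7) i)).
    by rewrite wt_prefix.
  have [d [Gd Ed dv]] := coset c _ Gc (affine_part_rm14 (bits (v c))).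
  exists d; split; rewrite ?Ed // dv; apply: normalized_affine_part.
  by rewrite size_bits.
have [c cP] := fin_all_exists reps.
pose b i := coeffs (bits (v (c i))).
have bP i : b i \in nonsingular /\ bits (v (c i)) = quad (b i).
  have [Gc Ec nc] := cP i; have [|a aN Ea] := bent _ Gc _ nc; first by rewrite Ec wt_prefix.
  by rewrite /b Ea quadK //; move: aN; rewrite mem_filter => /andP[].
(* The prefixes of [c i] and [c j] share the last coordinate of J*, so their sum again has weight 2
   and the sum of the two words is bent as well. *)
have bA i j : i != j -> pfaffian (xorv (b i) (b j)).
  move=> ij; have [[Gi Ei ni] [Gj Ej nj]] := (cP i, cP j).
  have [||a] := bent (c i + c j) (GD Gi Gj).
  - by rewrite linearD /= Ei Ej addrACA addF2v addr0 wt_delta2.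
  - by rewrite vD normalizedD ?size_bits.
  rewrite mem_filter vD => /andP[pa a6] E.
  by rewrite -coeffsD ?size_bits // E quadK.
have [k k8 kb] := kerdock_choice (fun i => (bP i).1) bA.
have [g gE] := perm_of_seq (allP twist_perm_check _ k8).
exists (s * g)%g; split.
  rewrite permM s0; apply: val_inj; move/(congr1 (head 0%N)): gE.
  by rewrite enum_ordSl.
(* One inclusion suffices: the standard code has 256 words and NR(G) at most 256. *)
apply/esym/eqP; rewrite eqEcard; apply/andP; split; last first.
  apply: leq_trans (leq_imset_card _ _) _; apply: leq_trans card_Dunion _.
  rewrite card_imset; last exact: can_inj (col_permK _).
  by have /andP[sz /eqP <-] := size_nr_std; rewrite card_bits // nr_std_uniq.
apply/subsetP => ? /imsetP[w]; rewrite in_set => ws ->.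
suff [d [Gd [i Ei] dv]] : exists d, [/\ d \in G, exists i, lsubmx d = prefix i
    & v d = col_perm g w].
  apply/imsetP; exists d; first by apply/mem_Dunion; split=> //; exists i.
  by apply/rowP => j; rewrite col_permM -dv vK !mxE.
(* The twisted word is its affine part plus 0 or a form of [kerdock k]. A word of G realising that
   form is shifted within its coset to give it. *)
move/allP: twist_check => /(_ k k8)/allP/(_ (bits (col_perm g w))).
rewrite bits_col_perm gE map_f // => /(_ isT); rewrite -gE -bits_col_perm.
set x := col_perm g w; case/mapP => a ka Ea.
have xE : bits x = xorv (quad a) (affine_part (bits x)).
  by rewrite -Ea xorvK // size_bits.
have lift c0 : c0 \in G -> bits (v c0) = quad a ->
    exists d, [/\ d \in G, lsubmx d = lsubmx c0 & v d = x].
  move=> Gc Ec; have [d [Gd Ed dv]] := coset c0 _ Gc (affine_part_rm14 (bits x)).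
  by exists d; split=> //; apply: bits_inj; rewrite dv Ec.
move: ka; rewrite inE => /orP[/eqP a0|/kb[i ai]].
  have [|d [Gd Ed dv]] := lift 0 G0.
    by rewrite a0 (_ : v 0 = 0) ?bits0 //; apply/rowP => j; rewrite !mxE.
  by exists d; split=> //; exists ord_max; rewrite Ed linear0 addF2v.
have [Gc Ec _] := cP i; have [|d [Gd Ed dv]] := lift (c i) Gc.
  by rewrite ai (bP i).2.
by exists d; split=> //; exists (widen_ord (leqnSn 7) i); rewrite Ed.
Qed.

End Golay.

(** * Distance to a code and automorphisms *)

Section Distance.
Variable n : nat.
Implicit Types (C : {set vec n}) (x y : vec n).

Lemma bigminn_le (T : eqType) (r : seq T) (F : T -> nat) c :
  c \in r -> (\big[minn/n]_(i <- r) F i <= F c)%N.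
Proof.
elim: r => // d r IHr; rewrite inE big_cons geq_min => /orP[/eqP->|/IHr->].
  by rewrite leqnn.
by rewrite orbT.
Qed.

Lemma bigminn_attained (T : eqType) (r : seq T) (F : T -> nat) :
  \big[minn/n]_(i <- r) F i = n \/ exists2 c, c \in r & \big[minn/n]_(i <- r) F i = F c.
Proof.
elim: r => [|d r IHr]; first by left; rewrite big_nil.
rewrite big_cons; case: leqP => [_|_].
  by right; exists d; rewrite ?mem_head.
by case: IHr => [|[c cr Ec]]; [left | right; exists c; rewrite // inE cr orbT].
Qed.

Lemma hdist_le x y : (hdist x y <= n)%N.
Proof. by rewrite -[leqRHS]card_ord max_card. Qed.

Lemma dist_code_le C x c : c \in C -> (dist_code C x <= hdist x c)%N.
Proof.
move=> Cc; rewrite /dist_code -big_filter bigminn_le //.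
by rewrite mem_filter Cc mem_index_enum.
Qed.

Lemma dist_code_attained C x : C != set0 -> exists2 c, c \in C & dist_code C x = hdist x c.
Proof.
case/set0Pn => c Cc; have := dist_code_le x Cc; rewrite /dist_code -big_filter.
set r := [seq _ <- _ | _]; case: (bigminn_attained r (hdist x)) => [-> n_le|[d + ->]].
  (* Here the minimum is the default [n]; as no distance exceeds [n], [c] attains it. *)
  by exists c => //; apply/eqP; rewrite eqn_leq n_le hdist_le.
by rewrite /r mem_filter => /andP[Cd _] _; exists d.
Qed.

Lemma dist_code_isometry (f : vec n -> vec n) C x :
  (forall y z, hdist (f y) (f z) = hdist y z) -> C != set0 ->
  dist_code (f @: C) (f x) = dist_code C x.
Proof.
move=> isof C0; have fC0 : f @: C != set0.
  by case/set0Pn: C0 => c Cc; apply/set0Pn; exists (f c); rewrite imset_f.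
apply/eqP; rewrite eqn_leq; apply/andP; split.
  have [c Cc ->] := dist_code_attained x C0.
  by rewrite -isof dist_code_le ?imset_f.
by have [? /imsetP[c Cc ->] ->] := dist_code_attained (f x) fC0; rewrite isof dist_code_le.
Qed.

Lemma hdist_hact g x y : hdist (hact g x) (hact g y) = hdist x y.
Proof.
rewrite !hdistE -(wt_col_perm g.2 (x + y)) /hact addrACA addF2v addr0.
by rewrite linearD.
Qed.

Lemma hact_inj g : injective (@hact n g).
Proof. by move=> x y /addIr/(can_inj (col_permK _)). Qed.

Lemma mem_AutC C g : {in C, forall c, hact g c \in C} -> g \in AutC C.
Proof.
move=> gC; rewrite inE eqEcard (card_imset _ (@hact_inj g)) leqnn andbT.
by apply/subsetP => ? /imsetP[c Cc ->]; exact: gC.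
Qed.

Lemma AutC_stable C g c : g \in AutC C -> c \in C -> hact g c \in C.
Proof. by rewrite inE => /eqP gC Cc; rewrite -gC imset_f. Qed.

(** The orbit relation. [AutC C] is a plain set of pairs, so composition and inverse are given by
    explicit formulas below. *)
Definition connected C x y := exists2 g, g \in AutC C & hact g x = y.

Lemma connected_refl C x : connected C x x.
Proof.
have E y : hact (0, 1%g) y = y by rewrite /hact addr0 col_perm1.
by exists (0, 1%g); rewrite ?E //; apply: mem_AutC => c; rewrite E.
Qed.

Lemma connected_trans C x y z : connected C x y -> connected C y z -> connected C x z.
Proof.
move=> [g gC <-] [h hC <-].
have E w : hact (col_perm h.2 g.1 + h.1, (h.2 * g.2)%g) w = hact h (hact g w).
  by apply/rowP => i; rewrite !mxE permM addrA.
exists (col_perm h.2 g.1 + h.1, (h.2 * g.2)%g) => //.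
by apply: mem_AutC => c Cc; rewrite E !AutC_stable.
Qed.

Lemma connected_sym C x y : connected C x y -> connected C y x.
Proof.
move=> [[t s] gC <-].
have E w : hact (col_perm s^-1 t, (s^-1)%g) (hact (t, s) w) = w.
  by rewrite /hact /= linearD /= col_permK addF2K.
exists (col_perm s^-1 t, (s^-1)%g) => //; apply: mem_AutC => c Cc.
by move: gC; rewrite inE => /eqP gC; move: Cc; rewrite -{1}gC => /imsetP[d Cd ->]; rewrite E.
Qed.

Lemma connected_dist C x y : C != set0 -> connected C x y -> dist_code C x = dist_code C y.
Proof.
move=> C0 [g]; rewrite inE => /eqP gC <-; rewrite -{2}gC dist_code_isometry //.
by move=> *; exact: hdist_hact.
Qed.

Lemma completely_transitive_criterion C m : C != set0 ->
  (forall x, dist_code C x <= m)%N ->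
  (forall i, (i <= m)%N -> exists x, dist_code C x = i) ->
  (forall x y, dist_code C x = dist_code C y -> connected C x y) ->
  completely_transitive (AutC C) C.
Proof.
move=> C0 le_m ex_i conn i le_i.
have [|x xi] := ex_i i; first by apply: leq_trans le_i _; apply/bigmax_leqP => x _.
exists x; apply/setP => y; rewrite inE; apply/eqP/imsetP => [yi|[g gC ->]].
  by have [|g gC <-] := conn x y; [rewrite xi yi | exists g].
by rewrite -xi; apply/esym/connected_dist => //; exists g.
Qed.

(** Conjugation by [q] carries automorphisms of the code to automorphisms of its image. *)
Lemma connected_col_perm C (q : {perm 'I_n}) x y : connected C x y ->
  connected (col_perm q @: C) (col_perm q x) (col_perm q y).
Proof.
move=> [[t s] gC <-].
have E w : hact (col_perm q t, (q * s * q^-1)%g) (col_perm q w) = col_perm q (hact (t, s) w).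
  by apply/rowP => i; rewrite !mxE !permM permKV.
exists (col_perm q t, (q * s * q^-1)%g) => //; apply: mem_AutC => ? /imsetP[c Cc ->].
by rewrite E imset_f // AutC_stable.
Qed.

End Distance.

(** * The standard punctured Nordstrom-Robinson code *)

Definition pn_std : seq (seq bool) := map behead nr_std.

Definition gen_act (g : seq bool * seq nat) (v : seq bool) : seq bool :=
  xorv (permv g.2 v) g.1.

Definition puncture_seq (s : seq nat) : seq nat := map predn (behead s).

(* Two linear permutations of F_2^4 preserving the Kerdock set [kerdock_base],
   found by computer; [puncture_seq] removes the fixed point 0. *)
Definition perm_gens : seq (seq bool * seq nat) :=
  [seq (nseq 15 false, puncture_seq s) | s <-
    [:: [:: 0; 10; 6; 12; 14; 4; 8; 2; 9; 3; 15; 5; 7; 13; 1; 11];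
        [:: 0; 15; 14; 1; 7; 8; 9; 6; 10; 5; 4; 11; 13; 2; 3; 12]]%N].

(* The first generator moves 0 out of RM(1,4); the next ones are translations
   by a basis of RM(1,4). *)
Definition gens : seq (seq bool * seq nat) :=
  (behead (quad (head zero_form kerdock_base)), puncture_seq (twist 1)) ::
  [seq (behead (affine (set_nth false (nseq 5 false) k true)), iota 0 15) | k <- iota 0 5] ++
  perm_gens.

(* Breadth-first search from [frontier], of depth [fuel]. *)
Fixpoint reach (gs : seq (seq bool * seq nat)) (fuel : nat) (seen frontier : seq (seq bool)) :=
  if fuel is m.+1 then
    let new := undup [seq v <- [seq gen_act g v | v <- frontier, g <- gs] | v \notin seen] in
    reach gs m (new ++ seen) new
  else seen.

Fixpoint words_wt (n k : nat) : seq (seq bool) :=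
  if n is m.+1 then
    (if k is l.+1 then map (cons true) (words_wt m l) else [::]) ++
    map (cons false) (words_wt m k)
  else if k is 0 then [:: [::]] else [::].

(* For i = 3 this is the line {1, 2, 3} of PG(3,2), point p having index p - 1. *)
Definition rep (i : nat) : seq bool := [seq (p < i)%N | p <- iota 0 15].

Definition far_from_pn (i : nat) (v : seq bool) : bool :=
  all (fun c => i <= wtv (xorv v c))%N pn_std.

Lemma gens_check : all (fun g => [&& size g.1 == 15, perm_eq g.2 (iota 0 15) &
  all (mem pn_std) (map (gen_act g) pn_std)])%N gens.
Proof. by vm_compute. Qed.

(** Every word the search lists is reachable, so too small a fuel could only make the check fail. *)
Lemma reach_code_check :
  all (mem (reach gens 12 [:: nseq 15 false] [:: nseq 15 false])) pn_std.
Proof. by vm_compute. Qed.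

Lemma reach_rep_check :
  all (fun i => all (mem (reach perm_gens 8 [:: rep i] [:: rep i]))
    [seq v <- words_wt 15 i | far_from_pn i v]) (iota 0 4).
Proof. by vm_compute. Qed.

Lemma rep_check : all (fun i => (wtv (rep i) == i) && far_from_pn i (rep i)) (iota 0 4).
Proof. by vm_compute. Qed.

(** Distance to the code is invariant under adding words of RM(1,4), so normalized words suffice;
    [behead] ignores the punctured coordinate. *)
Lemma covering_check :
  all (fun v => has (fun c => wtv (behead (xorv v c)) <= 3)%N nr_std) (map place (words 11)).
Proof. by vm_compute. Qed.

Lemma rm14_closed_check :
  all (fun r => all (mem rm14) (map (xorv r) rm14)) rm14.
Proof. by vm_compute. Qed.

Lemma mem_words_wt v : v \in words_wt (size v) (wtv v).
Proof.
elim: v => //= -[] v IHv; rewrite mem_cat.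
  by rewrite (map_f (cons true)).
by rewrite add0n (map_f (cons false)) ?orbT.
Qed.

Lemma xorvA : associative xorv.
Proof.
elim=> [|a u IHu] [|b v] [|c w] //=.
by rewrite /xorv /= in IHu *; rewrite IHu addbA.
Qed.

Lemma xorvC : commutative xorv.
Proof.
elim=> [|a u IHu] [|b v] //=.
by rewrite /xorv /= in IHu *; rewrite IHu addbC.
Qed.

Lemma behead_xorv v w : behead (xorv v w) = xorv (behead v) (behead w).
Proof. by case: v w => [|b [|b' v]] [|c [|c' w]]. Qed.

Lemma reach_ind (P : seq bool -> Prop) gs fuel seen frontier :
  (forall g v, g \in gs -> P v -> P (gen_act g v)) ->
  (forall v, v \in seen -> P v) -> (forall v, v \in frontier -> P v) ->
  forall v, v \in reach gs fuel seen frontier -> P v.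
Proof.
move=> Pgs; elim: fuel seen frontier => [|m IHm] seen frontier Ps Pf //=.
set new := undup _; have Pnew v : v \in new -> P v.
  rewrite mem_undup mem_filter => /andP[_ /allpairsP[[w g] [/= wf gg ->]]].
  exact/Pgs/Pf.
by apply: IHm => // v; rewrite mem_cat => /orP[/Pnew|/Ps].
Qed.

Definition PN_std : {set vec 15} := [set x | bits x \in pn_std].

Lemma mem_PN_std x : (x \in PN_std) = (bits x \in pn_std).
Proof. by rewrite in_set. Qed.

Lemma size_pn_std v : v \in pn_std -> size v = 15%N.
Proof.
case/mapP => w ws ->; rewrite size_behead.
by have /andP[/allP/(_ w ws)/eqP-> _] := size_nr_std.
Qed.

Lemma PN_std0 : 0 \in PN_std.
Proof. by rewrite mem_PN_std bits0; vm_compute. Qed.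

Lemma PN_std_neq0 : PN_std != set0.
Proof. by apply/set0Pn; exists 0; exact: PN_std0. Qed.

Lemma gens_AutC g : g \in gens ->
  exists2 h, h \in AutC PN_std & forall x, bits (hact h x) = gen_act g (bits x).
Proof.
move=> /(allP gens_check)/and3P[/eqP sg /perm_of_seq[s sE] /allP gC].
have hE x : bits (hact (unbits 15 g.1, s) x) = gen_act g (bits x).
  by rewrite bitsD bits_col_perm sE unbitsK.
exists (unbits 15 g.1, s) => //; apply: mem_AutC => c.
by rewrite !mem_PN_std hE => Cc; apply: gC; exact: map_f.
Qed.

Lemma reach_connected gs m x y : {subset gs <= gens} ->
  bits y \in reach gs m [:: bits x] [:: bits x] -> connected PN_std x y.
Proof.
move=> gsP; pose P v := exists2 z, bits z = v & connected PN_std x z.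
have Px v : v \in [:: bits x] -> P v.
  by rewrite inE => /eqP->; exists x => //; exact: connected_refl.
move/(@reach_ind P) => []// => [g v /gsP gg [z <- xz]|z /bits_inj <- //].
have [h hC hE] := gens_AutC gg; exists (hact h z); rewrite ?hE //.
by apply: connected_trans xz _; exists h.
Qed.

Lemma PN_std_connected y : y \in PN_std -> connected PN_std 0 y.
Proof.
rewrite mem_PN_std => yC.
apply: (@reach_connected gens 12 _ _ (fun g gg => gg)); rewrite bits0.
exact: (allP reach_code_check _ yC).
Qed.

Lemma PN_std_covering x : (dist_code PN_std x <= 3)%N.
Proof.
(* The punctured coordinate is filled in arbitrarily, as [behead] drops it again. *)
pose v := false :: bits x; have sv : size v = 16%N by rewrite /= size_bits.
set r := affine_part v; have Rr : r \in rm14 by exact: affine_part_rm14.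
have : xorv v r \in map place (words 11).
  apply: normalized_place; last exact: normalized_affine_part.
  exact: size_xorv sv (size_affine_part v).
case/(allP covering_check)/hasP => c /allpairsP[[a r'] [/= aK Rr' ->]].
have -> : behead (xorv (xorv v r) (xorv (quad a) r')) =
    xorv (bits x) (behead (xorv (quad a) (xorv r r'))).
  rewrite -[bits x]/(behead v) -behead_xorv -xorvA; congr (behead (xorv _ _)).
  by rewrite xorvA (xorvC r) -xorvA.
move=> le3.
have Ss : xorv (quad a) (xorv r r') \in nr_std.
  apply: (allpairs_f (fun a r => xorv (quad a) r) aK).
  by apply: (allP (allP rm14_closed_check r Rr)); exact: (map_f (xorv r)) Rr'.
have sc : behead (xorv (quad a) (xorv r r')) \in pn_std by exact: map_f.
have := @dist_code_le _ PN_std x (unbits 15 (behead (xorv (quad a) (xorv r r')))).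
rewrite mem_PN_std (unbitsK (size_pn_std sc)) => /(_ sc) le_d; apply: leq_trans le_d _.
by rewrite hdistE -wt_bits bitsD (unbitsK (size_pn_std sc)).
Qed.

Lemma far_from_pnP i x :
  far_from_pn i (bits x) <-> forall c, c \in PN_std -> (i <= hdist x c)%N.
Proof.
split=> [/allP far c|far].
  by rewrite mem_PN_std => /far; rewrite hdistE -wt_bits bitsD.
apply/allP => v vC; have := far (unbits 15 v).
by rewrite mem_PN_std hdistE -wt_bits bitsD unbitsK ?size_pn_std //; apply.
Qed.

Lemma size_rep i : size (rep i) = 15%N.
Proof. by []. Qed.

Lemma dist_rep i : (i <= 3)%N -> dist_code PN_std (unbits 15 (rep i)) = i.
Proof.
move=> i3; have : i \in iota 0 4 by rewrite mem_iota.
case/(allP rep_check)/andP => /eqP wi far.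
apply/eqP; rewrite eqn_leq; apply/andP; split.
  apply: leq_trans (dist_code_le _ PN_std0) _.
  by rewrite hdistE addr0 -wt_bits unbitsK // wi.
have [c Cc ->] := dist_code_attained (unbits 15 (rep i)) PN_std_neq0.
by move: c Cc; apply/far_from_pnP; rewrite unbitsK.
Qed.

(** An automorphism moves a nearest codeword to 0, turning [x] into a word of weight i at distance i
    from the code. The permutations fixing 0 are transitive on such words. *)
Lemma connected_rep x : connected PN_std (unbits 15 (rep (dist_code PN_std x))) x.
Proof.
have [i Ei] : exists i, i = dist_code PN_std x by exists (dist_code PN_std x).
have i3 : i \in iota 0 4 by rewrite Ei mem_iota ltnS PN_std_covering.
have [c Cc xc] := dist_code_attained x PN_std_neq0.
have [h hC h0] := connected_sym (PN_std_connected Cc).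
have xh : connected PN_std x (hact h x) by exists h.
apply: connected_trans (connected_sym xh).
apply: (@reach_connected perm_gens 8) => [g gg|].
  by rewrite /gens in_cons mem_cat gg !orbT.
have vr v : v \in [seq v <- words_wt 15 i | far_from_pn i v] ->
    v \in reach perm_gens 8 [:: rep i] [:: rep i].
  exact: (allP (allP reach_rep_check i i3)).
rewrite -Ei (unbitsK (size_rep i)); apply: vr; rewrite mem_filter.
apply/andP; split.
  by apply/far_from_pnP => d Cd; rewrite Ei (connected_dist PN_std_neq0 xh) dist_code_le.
have -> : i = wtv (bits (hact h x)).
  by rewrite wt_bits -[hact h x]addr0 -hdistE -h0 hdist_hact Ei.
by have := mem_words_wt (bits (hact h x)); rewrite size_bits.
Qed.

(** * Puncturing and transfer to an arbitrary Golay code *)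

Definition puncture_word (v : vec 16) : vec 15 := \row_j v 0 (@rshift 1 15 j).

Lemma bits_puncture v : bits (puncture_word v) = behead (bits v).
Proof.
apply: bitsP => [|j]; first by rewrite size_behead size_bits.
by rewrite nth_behead mxE -nth_bits.
Qed.

Lemma perm_fix0 n (p : {perm 'I_(1 + n)}) : p 0 = 0 ->
  exists q : {perm 'I_n}, forall j, p (rshift 1 j) = rshift 1 (q j).
Proof.
move=> p0; have ex j : exists k, p (rshift 1 j) = rshift 1 k.
  case: (split_ordP (p (rshift 1 j))) => k E; last by exists k.
  have : p (rshift 1 j) = p 0 by rewrite p0 E; apply: val_inj; rewrite /= ord1.
  by move/perm_inj/(congr1 val).
have [f fE] := fin_all_exists ex.
have f_inj : injective f.
  by move=> i j E; apply: (@rshift_inj 1); apply: (@perm_inj _ p); rewrite !fE E.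
by exists (perm f_inj) => j; rewrite permE.
Qed.

Lemma PN_std_punctured : PN_std = puncture_word @: [set v | bits v \in nr_std].
Proof.
apply/setP => x; rewrite mem_PN_std; apply/mapP/imsetP => [[w ws xw]|[w]].
  have sw : size w = 16%N by have /andP[/allP/(_ w ws)/eqP] := size_nr_std.
  exists (unbits 16 w); first by rewrite in_set unbitsK.
  by apply: bits_inj; rewrite bits_puncture unbitsK.
by rewrite in_set => ws ->; exists (bits w); rewrite ?bits_puncture.
Qed.

Theorem theorem3p4 (G : {set 'rV['F_2]_24}) :
  is_ext_golay G -> one8 \in G ->
  completely_transitive (AutC (PN G)) (PN G).
Proof.
case=> G0 GD cardG minG _ G1.
have G1' : row_mx (const_mx 1 : vec 8) (0 : vec 16) \in G.
  suff <- : one8 = row_mx (const_mx 1 : vec 8) (0 : vec 16) by [].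
  apply/rowP => k; rewrite !mxE /=.
  by case: (@splitP 8 16 k) => j _; rewrite mxE.
have [p [p0 NRE]] := @golay_NR G G0 GD cardG minG G1'.
have [q qE] := @perm_fix0 15 p p0.
(* Since [p] fixes the deleted coordinate, it induces [q] on the other fifteen. *)
have PNE : PN G = col_perm q @: PN_std.
  rewrite /PN NRE PN_std_punctured /puncture -!imset_comp; apply: eq_imset => v /=.
  by apply/rowP => j; rewrite !mxE qE.
have dist_q x : dist_code (col_perm q @: PN_std) (col_perm q x) = dist_code PN_std x.
  apply: dist_code_isometry PN_std_neq0 => y z.
  by rewrite !hdistE -linearD wt_col_perm.
rewrite PNE; apply: (@completely_transitive_criterion _ _ 3).
- by apply/set0Pn; exists (col_perm q 0); rewrite imset_f ?PN_std0.
- by move=> x; rewrite -[x](col_permKV q) dist_q PN_std_covering.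
- by move=> i i3; exists (col_perm q (unbits 15 (rep i))); rewrite dist_q dist_rep.
move=> x y; rewrite -[x](col_permKV q) -[y](col_permKV q) !dist_q => Exy.
apply: connected_col_perm; apply: connected_trans (connected_rep _).
by rewrite -Exy; apply/connected_sym/connected_rep.
Qed.
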